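(* Let $\ell,n,\Delta\in\mathbb{N}^+$. Then every deterministic $(\ell,n,\Delta)$-Static Ranker requires at least $$\mathcal{B}=\left\lfloor \frac{n}{\lceil \Delta/\ell\rceil}\right\rfloor\cdot\log_2\!\Big(\max\big\{\lfloor \ell/\Delta\rfloor,1\big\}+1\Big)$$ bits of memory.
   Context: For a value $V$ and $\epsilon>0$, $\widehat V$ is an $\epsilon$-additive approximation of $V$ if $V-\epsilon<\widehat V\le V$. For $\ell,n,\Delta\in\mathbb{N}^+$, an $(\ell,n,\Delta)$-Static Ranker is a data structure that preprocesses a sequence $x=(x_1,\dots,x_n)\in\{0,1,\dots,\ell\}^n$ and, when queried with any $i\le n$, returns (in $O(1)$ time, word RAM with word size $\Theta(\log n+\log\ell)$) a $\Delta$-additive approximation of $S_i=\sum_{d=1}^i x_d$. Its memory is the number of bits of the structure stored after preprocessing (on which the answers to queries depend). *)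

(* Defs.v *)
From HB Require Import structures.
From mathcomp Require Import all_boot all_order all_algebra.
From mathcomp Require Import reals exp.

Set Implicit Arguments.
Unset Strict Implicit.
Unset Printing Implicit Defensive.

Import Order.TTheory GRing.Theory Num.Theory.
Local Open Scope ring_scope.

Definition additive_approx (R : realType) (eps V V' : R) : Prop :=
  V - eps < V' /\ V' <= V.

(* S_i = x_1 + ... + x_i; as indices start at 0 here, x_d is [tnth x (d - 1)]. *)
Definition prefix_sum (l n : nat) (x : n.-tuple 'I_l.+1) (i : nat) : nat :=
  (\sum_(d < n | d < i) tnth x d)%N.

(* A deterministic (l, n, Delta)-static ranker: preprocessing stores a block of
   [memory] bits, and queries see only these bits and the index. Query time is
   left out: for fixed l, n and Delta, O(1) time excludes no query function, so
   quantifying over this type covers every O(1)-time word-RAM ranker. Answers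
   may be arbitrary reals. *)
Record static_ranker (R : realType) (l n Delta : nat) : Type := StaticRanker {
  memory : nat;
  preprocess : n.-tuple 'I_l.+1 -> memory.-tuple bool;
  query : memory.-tuple bool -> nat -> R;
  queryP : forall (x : n.-tuple 'I_l.+1) (i : nat), (i <= n)%N ->
    additive_approx (Delta%:R) ((prefix_sum x i)%:R) (query (preprocess x) i)
}.

Definition log2 (R : realType) (x : R) : R := ln x / ln 2.

(* Main.v *)
Require Import Defs.
From mathcomp Require Import all_boot all_order all_algebra.
From mathcomp Require Import reals exp.
From mathcomp Require Import zify lra.

(** Put [c = ceil (Delta / l)] and [m = max (floor (l / Delta)) 1], and cut the
    sequence into [n %/ c] blocks of length [c].  A word over [{0, .., m}] with
    one letter per block is encoded by repeating [minn l Delta] times the letter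
    throughout its block.  If two words first differ in block [j], their prefix
    sums at the end of that block differ by at least [c * minn l Delta >= Delta],
    and no real is a [Delta]-additive approximation of both.  So distinct words
    are stored differently, which gives [(m + 1) ^ (n %/ c) <= 2 ^ memory]. *)

Set Implicit Arguments.
Unset Strict Implicit.
Unset Printing Implicit Defensive.

Import Order.TTheory GRing.Theory Num.Theory.
Local Open Scope ring_scope.

(** Chain [V - e < a <= W]; the strict side is what separates sums differing by exactly [e]. *)
Lemma additive_approx_lt (R : realType) (e V W a : R) :
  additive_approx e V a -> additive_approx e W a -> V < W + e.
Proof. by move=> [h1 h2] [h3 h4]; lra. Qed.

Lemma prefix_sum_nat (l n : nat) (x : n.-tuple 'I_l.+1) (G : nat -> nat) i :
    (i <= n)%N -> (forall d : 'I_n, tnth x d = G d :> nat) ->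
  prefix_sum x i = (\sum_(0 <= d < i) G d)%N.
Proof.
move=> le_in xG; rewrite /prefix_sum.
rewrite (eq_bigr (fun d : 'I_n => G d)); last by move=> d _; exact: xG.
by rewrite -(big_mkord (fun d => d < i)%N G) (big_nat_widen _ _ _ _ _ le_in).
Qed.

Section BlockEncoding.
Variables (l n c v m : nat).
Hypotheses (c_gt0 : (0 < c)%N) (vm_le : (v * m <= l)%N).
Implicit Types f g : (n %/ c).-tuple 'I_m.+1.

(** By [vm_le] the entries stay within [l], so [inord] never falls back to its default. Positions
    after the last full block get the default letter [ord0], hence entry 0. *)
Definition block_tuple f : n.-tuple 'I_l.+1 :=
  [tuple inord (v * nth ord0 f (d %/ c)%N)%N | d < n].

Lemma tnth_block_tuple f (d : 'I_n) :
  tnth (block_tuple f) d = (v * nth ord0 f (d %/ c))%N :> nat.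
Proof.
rewrite tnth_mktuple inordK // ltnS (leq_trans _ vm_le) // leq_mul2l.
by rewrite -ltnS ltn_ord orbT.
Qed.

Lemma prefix_sum_block_tuple f (j : nat) : (j <= n %/ c)%N ->
  prefix_sum (block_tuple f) (j * c)%N =
  (\sum_(0 <= k < j) c * v * nth ord0 f k)%N.
Proof.
move=> le_j; rewrite (@prefix_sum_nat _ _ _
  (fun d => v * nth ord0 f (d %/ c))%N _ _ (tnth_block_tuple f)); last first.
  by rewrite (leq_trans _ (leq_divM n c)) // leq_mul2r le_j orbT.
elim: j {le_j} => [|j IHj]; first by rewrite !big_geq.
rewrite big_nat_recr //= -IHj (@big_cat_nat _ _ _ (j * c)%N) //=; last first.
  by rewrite leq_mul2r leqnSn orbT.
congr (_ + _)%N.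
rewrite (@eq_big_nat _ _ _ _ _ _ (fun=> v * nth ord0 f j)%N); last first.
  by move=> d /andP[jd dj]; rewrite (_ : d %/ c = j)%N //; nia.
by rewrite sum_nat_const_nat mulSn addnK mulnA.
Qed.

Lemma block_tuple_inj_approx (R : realType) (Delta : nat) f g (q : nat -> R) :
    (Delta <= c * v)%N ->
    (forall i, (i <= n)%N -> additive_approx (Delta%:R)
       (prefix_sum (block_tuple f) i)%:R (q i)) ->
    (forall i, (i <= n)%N -> additive_approx (Delta%:R)
       (prefix_sum (block_tuple g) i)%:R (q i)) ->
  f = g.
Proof.
move=> Delta_le qf qg.
have eq_fg j : (j < n %/ c)%N -> nth ord0 f j = nth ord0 g j :> nat.
  elim/ltn_ind: j => j IHj lt_j.
  have le_n : (j.+1 * c <= n)%N.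
    by rewrite (leq_trans _ (leq_divM n c)) // leq_mul2r lt_j orbT.
  (* The answers [q] serve both words, so their sums at the end of block [j] differ by less than
     [Delta] in either direction. *)
  have := additive_approx_lt (qf _ le_n) (qg _ le_n).
  have := additive_approx_lt (qg _ le_n) (qf _ le_n).
  rewrite -!natrD !ltr_nat !prefix_sum_block_tuple // !big_nat_recr //=.
  rewrite (@eq_big_nat _ _ _ 0%N j (fun k => c * v * nth ord0 f k)%N
             (fun k => c * v * nth ord0 g k)%N); last first.
    by move=> k /andP[_ kj]; rewrite IHj // (ltn_trans kj).
  (* The common contribution [s] of the earlier blocks cancels; unequal letters would leave a gap of
     at least [c * v >= Delta]. *)
  move: (\sum_(0 <= k < j) _)%N => s; nia.
by apply: eq_from_tnth => j; apply: val_inj; rewrite !(tnth_nth ord0) /= eq_fg.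
Qed.

(** Pigeonhole: [query] sees only the stored bits, so words stored alike share all answers and
    coincide. *)
Lemma expn_le_memory (R : realType) (Delta : nat)
    (A : static_ranker R l n Delta) :
  (Delta <= c * v)%N -> (m.+1 ^ (n %/ c) <= 2 ^ memory A)%N.
Proof.
move=> Delta_le.
have inj : injective (fun f => preprocess A (block_tuple f)).
  move=> f g /= eq_fg.
  pose q := query (preprocess A (block_tuple f)).
  apply: (@block_tuple_inj_approx R Delta _ _ q) => //.
    by move=> i; exact: queryP.
  by rewrite /q eq_fg => i; exact: queryP.
by have := leq_card _ inj; rewrite !card_tuple card_ord card_bool.
Qed.

End BlockEncoding.

Lemma floor_natr_div (R : realType) (a b : nat) : (0 < b)%N ->
  Num.floor ((a%:R : R) / b%:R) = (a %/ b)%N.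
Proof.
move=> b_gt0; apply: floor_def; have b_gt0R : (0 : R) < b%:R by rewrite ltr0n.
rewrite intrD -pmulrn ler_pdivlMr // ltr_pdivrMr // -natrM natr1 -natrM.
by rewrite ler_nat ltr_nat leq_divM ltn_ceil.
Qed.

Lemma log2_natrX_le (R : realType) (m k M : nat) : (m.+1 ^ k <= 2 ^ M)%N ->
  k%:R * log2 (m.+1%:R : R) <= M%:R.
Proof.
move=> le_exp; have ln2_gt0 : 0 < ln 2 :> R by rewrite ln_gt0 // ltr1n.
rewrite /log2 mulrA ler_pdivrMr // !mulr_natl -!lnXn ?ltr0n // -!natrX.
by rewrite ler_ln ?posrE ?ltr0n ?expn_gt0 // ler_nat.
Qed.

Theorem theorem2 (R : realType) (l n Delta : nat)
    (hl : (0 < l)%N) (hn : (0 < n)%N) (hDelta : (0 < Delta)%N)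
    (A : static_ranker R l n Delta) :
  (Num.floor ((n%:R : R) / (Num.ceil ((Delta%:R : R) / l%:R))%:~R))%:~R
    * log2 ((Num.max (Num.floor ((l%:R : R) / Delta%:R)) 1)%:~R + 1)
  <= ((memory A)%:R : R).
Proof.
have l_gt0 : (0 : R) < l%:R by rewrite ltr0n.
have [c c_gt0 ceilE] :
    exists2 c, (0 < c)%N & Num.ceil ((Delta%:R : R) / l%:R) = c%:Z.
  have : 0 < Num.ceil ((Delta%:R : R) / l%:R).
    by rewrite ceil_gt0 divr_gt0 ?ltr0n.
  by case: (Num.ceil _) => // c; exists c.
have Delta_le_cl : (Delta <= c * l)%N.
  have := ceil_ge ((Delta%:R : R) / l%:R).
  by rewrite ceilE ler_pdivrMr // -natrM ler_nat.
rewrite ceilE !floor_natr_div //.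
have -> : Num.max ((l %/ Delta)%N : int) 1 = (maxn (l %/ Delta) 1 : int) by lia.
rewrite -!pmulrn natr1; apply: log2_natrX_le.
apply: (@expn_le_memory l n c (minn l Delta)) => //.
  (* The largest entry fits: it is [Delta * (l %/ Delta)] if [Delta <= l], and [l * 1] otherwise. *)
  have := leq_divM l Delta; have [?|?] := leqP Delta l; first by nia.
  by rewrite divn_small //; lia.
(* Whichever term is the minimum, [Delta <= c * l] or [Delta <= c * Delta] applies. *)
by nia.
Qed.
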